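(* Let $G$ be a group with decidable word problem, with set of generators $\Sigma=\{x_1,\dots,x_m,x_1^{-1},\dots,x_m^{-1}\}$ and identity $e$, and let $\mathfrak{L}(G)=\{\omega\in\Sigma^*\mid \omega\equiv e \ (\mathrm{mod}\ G)\}$. Let $L$ be a regular language and let $L=L(A)$, where $A=(Q,\Sigma,\delta,q_1,Z)$ is a (deterministic or nondeterministic) finite automaton with $Q=\{q_1,\dots,q_n\}$. Let $\Gamma=(N,\Sigma,\Pi,A_1)$ be a context-free grammar generating $L$, and let $r$ be the constant of the pumping lemma for the context-free language $L$. With the notation of the context, define $$\Omega_1=\{\,\omega\in L\mid |\omega|\le r\,\},$$ $$\Omega_2=\{\,uwvw^{-1}\mid |uwv|\le r,\ uv\neq\varepsilon,\ \exists B\in N:\ B\stackrel{*}{\Rightarrow}uBv,\ B\stackrel{*}{\Rightarrow}w\,\},$$ $$\Omega_3=\{\,l_G(\pi)\mid \pi\in\widehat{P_{1Z}}\,\},$$ $$\Omega_4=\{\,uvu^{-1}\mid \exists q_j\in Q,\ \pi_1\in\widehat{P_{1j}},\ \pi_2\in O_j,\ \pi_3\in P_{jZ}:\ u=l_G(\pi_1),\ v=l_G(\pi_2)\,\},$$ $$\Omega_5=\{\,l_G(\pi)\mid \pi\in\mathcal{K}_{1t}^n,\ q_t\in Z\,\},$$ $$\Omega_6=\{\,l_G(\pi_1)\,l_G(\pi_2)\,l_G(\pi_1)^{-1}\mid q_j\in Q,\ q_t\in Z,\ \mathcal{K}_{jt}^n\neq\emptyset,\ \pi_1\in\mathcal{K}_{1j}^n,\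 \pi_2\in\mathcal{K}_{jj}^n\,\},$$ and put $W_1=\Omega_1\cup\Omega_2$ (its words being regarded as elements of $G$), $W_2=\Omega_3\cup\Omega_4$, $W_3=\Omega_5\cup\Omega_6$. Then the following conditions are equivalent: (i) $L\subseteq\mathfrak{L}(G)$; (ii) $W_1=\Omega_1\cup\Omega_2=\{e\}$; (iii) $W_2=\Omega_3\cup\Omega_4=\{e\}$; (iv) $W_3=\Omega_5\cup\Omega_6=\{e\}$.
   Context: $\Sigma^*$ is the free monoid over the finite alphabet $\Sigma$, $\varepsilon$ is the empty word, $|\omega|$ is the length of the word $\omega$; the letter $x_i^{-1}$ represents in $G$ the inverse of the element represented by $x_i$, and $w^{-1}$ denotes the inverse word of $w$ (letters inverted and in reversed order). For a word $\omega$, $\omega\equiv e\ (\mathrm{mod}\ G)$ means that $\omega$ evaluates to the identity in $G$. Grammar: $N$ is the set of variables, $\Sigma$ the set of terminals, $\Pi$ the set of productions, $A_1\in N$ the start symbol; $\stackrel{*}{\Rightarrow}$ denotes derivability; $u,v,w$ in $\Omega_2$ are words over $\Sigma$. The constant $r$ of the pumping lemma for $L$ is the number such that every $z\in L$ with $|z|\ge r$ can be written $z=z_1uwvz_2$ with $|uwv|\le r$, $uv\ne\varepsilon$ and $z_1u^iwv^iz_2\in L$ for all $i\ge 0$. Automaton: $q_1$ is the start state, $Z\subseteq Q$ the set of final states, $\delta$ the transition function, and $L(A)=\{\omega\in\Sigma^*\mid\delta(q_1,\omega)\cap Z\neq\emptyset\}$. Transition diagram $H_G$: the transition diagram of $A$,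 i.e. the directed multigraph with vertex set $Q$ having an arc from $q_i$ to $q_j$ for every $a\in\Sigma$ with $q_j\in\delta(q_i,a)$; the label $l_G$ of this arc is $a$ considered as an element of $G$. For a walk $\pi=p_1p_2\cdots p_k$ (a sequence of consecutive arcs), $l_G(\pi)=l_G(p_1)\cdots l_G(p_k)\in G$. Sets of walks in $H_G$: $P_{ij}$ is the set of all walks from $q_i$ to $q_j$; $\widehat{P_{ij}}\subseteq P_{ij}$ is the set of those in which all vertices are distinct, except possibly $q_i=q_j$. $P_{iZ}$ is the set of all walks from $q_i$ to an element of $Z$; $\widehat{P_{iZ}}\subseteq P_{iZ}$ is the set of those in which all vertices are distinct (except possibly the initial and final vertices). $O_i=\widehat{P_{ii}}$. For $i,j\in\{1,\dots,n\}$ and $k\in\{0,\dots,n\}$ the sets of walks $\mathcal{K}_{ij}^k$ in $H_G$ are defined recursively: $\mathcal{K}_{ij}^0$ is the set of all arcs from $q_i$ to $q_j$, and for $k\ge1$, $\mathcal{K}_{ij}^k=\mathcal{K}_{ij}^{k-1}\cup\mathcal{K}_{ik}^{k-1}\mathcal{K}_{kj}^{k-1}$, where the product is the set of all concatenations of a walk of the first set with a walk of the second.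
   Formalization: Formalized with three conventions, without which the claim fails: r is a pumping constant whose factorizations come from a variable B of Γ (A_1⇒*z_1Bz_2, B⇒*uBv, B⇒*w); Γ has no useless variables; L is neither empty nor {ε}. *)

(* Defs.v *)
From HB Require Import structures.
From Stdlib Require Import Relation_Operators.
From mathcomp Require Import all_boot.
From mathcomp Require Import classical_sets.

Set Implicit Arguments.
Unset Strict Implicit.
Unset Printing Implicit Defensive.

Local Open Scope classical_set_scope.

(** * Words over x_1, ..., x_m, x_1^-1, ..., x_m^-1 *)

(* (i, false) is the formal letter x_i and (i, true) the formal letter x_i^-1;
   distinct letters may represent the same element of the group. *)
Definition letter (m : nat) : Type := ('I_m * bool)%type.
Definition word (m : nat) : Type := seq (letter m).

Definition inv_letter (m : nat) (a : letter m) : letter m := (a.1, ~~ a.2).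
Definition inv_word (m : nat) (w : word m) : word m :=
  rev [seq inv_letter a | a <- w].

Definition letter_val (G : groupType) (m : nat) (x : 'I_m -> G)
    (a : letter m) : G :=
  if a.2 then ((x a.1)^-1)%g else x a.1.

Definition word_val (G : groupType) (m : nat) (x : 'I_m -> G) (w : word m) : G :=
  (\big[*%g/1%g]_(a <- w) letter_val x a)%g.

Definition generates (G : groupType) (m : nat) (x : 'I_m -> G) : Prop :=
  forall g : G, exists w : word m, word_val x w = g.

Definition identity_language (G : groupType) (m : nat) (x : 'I_m -> G) :
    set (word m) :=
  [set w | word_val x w = 1%g].

(** * Algorithmic decidability, via partial recursive functions *)

Inductive recfun : Type :=
| RZero
| RSucc
| RProj of nat
| RComp of recfun & seq recfun
| RPrec of recfun & recfun
| RMu of recfun.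

(* [rec_eval f s y]: the partial function coded by f is defined at the argument
   tuple s, with value y. *)
Inductive rec_eval : recfun -> seq nat -> nat -> Prop :=
| eval_zero s : rec_eval RZero s 0
| eval_succ n s : rec_eval RSucc (n :: s) n.+1
| eval_proj i s : i < size s -> rec_eval (RProj i) s (nth 0 s i)
| eval_comp f gs s t y :
    rec_evals gs s t -> rec_eval f t y -> rec_eval (RComp f gs) s y
| eval_prec0 f g s y : rec_eval f s y -> rec_eval (RPrec f g) (0 :: s) y
| eval_precS f g n s z y :
    rec_eval (RPrec f g) (n :: s) z -> rec_eval g [:: n, z & s] y ->
    rec_eval (RPrec f g) (n.+1 :: s) y
| eval_mu f s y :
    rec_eval f (y :: s) 0 ->
    (forall z, z < y -> exists v, rec_eval f (z :: s) v.+1) ->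
    rec_eval (RMu f) s y
with rec_evals : seq recfun -> seq nat -> seq nat -> Prop :=
| evals_nil s : rec_evals [::] s [::]
| evals_cons g gs s y t :
    rec_eval g s y -> rec_evals gs s t -> rec_evals (g :: gs) s (y :: t).

(* Goedel number of a word: x_i^(+/-1) is numbered 2i or 2i+1, and CodeSeq.code
   is an effective bijection from finite sequences of naturals to naturals. *)
Definition word_code (m : nat) (w : word m) : nat :=
  CodeSeq.code [seq (nat_of_ord a.1).*2 + nat_of_bool a.2 | a <- w].

Definition decidable_language (m : nat) (D : set (word m)) : Prop :=
  exists f : recfun, forall w : word m,
    (D w -> rec_eval f [:: word_code w] 1) /\
    (~ D w -> rec_eval f [:: word_code w] 0).

Definition decidable_word_problem (G : groupType) (m : nat) (x : 'I_m -> G) :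
    Prop :=
  decidable_language (identity_language x).

(** * Finite automata *)

(* The states q_1, ..., q_n.+1 are the elements of 'I_n.+1, with q_1 = ord0.
   A deterministic automaton is the case where all the sets [nfa_delta q a] are
   singletons. *)
Record nfa (m n : nat) := Nfa {
  nfa_delta : 'I_n.+1 -> letter m -> {set 'I_n.+1};
  nfa_final : {set 'I_n.+1} }.

Definition nfa_run (m n : nat) (A : nfa m n) (q : 'I_n.+1) (w : word m) :
    {set 'I_n.+1} :=
  foldl (fun (S : {set 'I_n.+1}) a => \bigcup_(p in S) nfa_delta A p a)%SET
        [set q]%SET w.

Definition nfa_lang (m n : nat) (A : nfa m n) : set (word m) :=
  [set w | (nfa_run A ord0 w :&: nfa_final A)%SET != finset.set0].

(** * Context-free grammars *)

(* In a sentential form, inl B is the variable B and inr a the terminal a. *)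
Record cfg (m : nat) := Cfg {
  cfg_var : finType;
  cfg_prod : seq (cfg_var * seq (cfg_var + letter m));
  cfg_start : cfg_var }.

Definition sform (m : nat) (Gam : cfg m) : Type := seq (cfg_var Gam + letter m).

Definition term (m : nat) (Gam : cfg m) (w : word m) : sform Gam :=
  [seq inr a | a <- w].

Definition derives1 (m : nat) (Gam : cfg m) (s t : sform Gam) : Prop :=
  exists (B : cfg_var Gam) (gam al be : sform Gam),
    [/\ (B, gam) \in cfg_prod Gam, s = al ++ inl B :: be
      & t = al ++ gam ++ be].

Definition derives (m : nat) (Gam : cfg m) : sform Gam -> sform Gam -> Prop :=
  clos_refl_trans (sform Gam) (@derives1 m Gam).

Definition cfg_lang (m : nat) (Gam : cfg m) : set (word m) :=
  [set w | derives [:: inl (cfg_start Gam)] (term Gam w)].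

(* B occurs in some derivation of a terminal word from the start symbol. *)
Definition useful (m : nat) (Gam : cfg m) (B : cfg_var Gam) : Prop :=
  exists (al be : sform Gam) (w : word m),
    derives [:: inl (cfg_start Gam)] (al ++ inl B :: be) /\
    derives (al ++ inl B :: be) (term Gam w).

(* The constant is tied to the grammar: as in the proof of the pumping lemma,
   the factorization of z comes from a variable B repeated in a derivation
   A_1 =>* z1 B z2, B =>* u B v, B =>* w of z in Gam. *)
Definition pumping_constant (m : nat) (Gam : cfg m) (r : nat) : Prop :=
  forall z : word m, cfg_lang Gam z -> r <= size z ->
  exists z1 u w v z2 : word m,
    [/\ z = z1 ++ u ++ w ++ v ++ z2,
        size (u ++ w ++ v) <= r,
        u ++ v <> [::],
        (forall i : nat,
           cfg_lang Gam (z1 ++ flatten (nseq i u) ++ w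
                            ++ flatten (nseq i v) ++ z2))
      & exists B : cfg_var Gam,
          [/\ derives [:: inl (cfg_start Gam)]
                      (term Gam z1 ++ inl B :: term Gam z2),
              derives [:: inl B] (term Gam u ++ inl B :: term Gam v)
            & derives [:: inl B] (term Gam w)]].

(** * Walks in the transition diagram *)

Definition arc (m n : nat) : Type := ('I_n.+1 * letter m * 'I_n.+1)%type.

Section Walks.
Variables (m n : nat) (A : nfa m n).
Implicit Types (i j k : 'I_n.+1) (b : arc m n) (p : seq (arc m n)).

Definition arc_src b := b.1.1.
Definition arc_letter b := b.1.2.
Definition arc_tgt b := b.2.

Definition arcs i j : set (arc m n) :=
  [set b | [/\ arc_src b = i, arc_tgt b = j
             & arc_tgt b \in nfa_delta A (arc_src b) (arc_letter b)]].

(* The empty sequence is the walk of length 0 from i to i. *)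
Fixpoint is_walk i p j : Prop :=
  if p is b :: p' then arcs i (arc_tgt b) b /\ is_walk (arc_tgt b) p' j
  else i = j.

Definition P_ i j : set (seq (arc m n)) := [set p | is_walk i p j].

Definition Phat i j : set (seq (arc m n)) :=
  [set p | is_walk i p j /\
     (uniq (i :: map arc_tgt p) || ((i == j) && uniq (map arc_tgt p)))].

Definition PZ i : set (seq (arc m n)) :=
  [set p | exists2 t, t \in nfa_final A & P_ i t p].

Definition PhatZ i : set (seq (arc m n)) :=
  [set p | exists2 t, t \in nfa_final A & Phat i t p].

Definition O_ i : set (seq (arc m n)) := Phat i i.

(* [inord l] is the state q_(l+1), so the step from l to l.+1 goes through
   q_(l+1). The family is only meaningful for k <= n.+1, the number of
   states. *)
Fixpoint K (k : nat) i j : set (seq (arc m n)) :=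
  if k is l.+1 then
    K l i j `|` [set p ++ q | p in K l i (inord l) & q in K l (inord l) j]
  else [set [:: b] | b in arcs i j].

End Walks.

Definition walk_val (G : groupType) (m n : nat) (x : 'I_m -> G)
    (p : seq (arc m n)) : G :=
  (\big[*%g/1%g]_(b <- p) letter_val x (arc_letter b))%g.

(** * The sets Omega_1, ..., Omega_6 *)

Definition Omega1 (m : nat) (L : set (word m)) (r : nat) : set (word m) :=
  [set w | L w /\ size w <= r].

Definition Omega2 (m : nat) (Gam : cfg m) (r : nat) : set (word m) :=
  [set y | exists u w v : word m,
     [/\ y = u ++ w ++ v ++ inv_word w,
         size (u ++ w ++ v) <= r,
         u ++ v <> [::]
       & exists B : cfg_var Gam,
           derives [:: inl B] (term Gam u ++ inl B :: term Gam v) /\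
           derives [:: inl B] (term Gam w)]].

Section OmegaDiagram.
Variables (G : groupType) (m n : nat) (x : 'I_m -> G) (A : nfa m n).

Definition Omega3 : set G := [set walk_val x p | p in PhatZ A ord0].

Definition Omega4 : set G :=
  [set g | exists (j : 'I_n.+1) (p1 p2 p3 : seq (arc m n)),
     [/\ Phat A ord0 j p1, O_ A j p2, PZ A j p3
       & g = (walk_val x p1 * walk_val x p2 * (walk_val x p1)^-1)%g]].

Definition Omega5 : set G :=
  [set g | exists (t : 'I_n.+1) (p : seq (arc m n)),
     [/\ t \in nfa_final A, K A n.+1 ord0 t p & g = walk_val x p]].

Definition Omega6 : set G :=
  [set g | exists (j t : 'I_n.+1) (p1 p2 : seq (arc m n)),
     [/\ t \in nfa_final A, K A n.+1 j t !=set0,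
         K A n.+1 ord0 j p1, K A n.+1 j j p2
       & g = (walk_val x p1 * walk_val x p2 * (walk_val x p1)^-1)%g]].

End OmegaDiagram.

Definition W1 (G : groupType) (m : nat) (x : 'I_m -> G) (L : set (word m))
    (Gam : cfg m) (r : nat) : set G :=
  word_val x @` (Omega1 L r `|` Omega2 Gam r).

Definition W2 (G : groupType) (m n : nat) (x : 'I_m -> G) (A : nfa m n) :
    set G :=
  Omega3 x A `|` Omega4 x A.

Definition W3 (G : groupType) (m n : nat) (x : 'I_m -> G) (A : nfa m n) :
    set G :=
  Omega5 x A `|` Omega6 x A.

(* Main.v *)
(* Values in G of words u w v and w (resp. of a walk with and without a cycle)
   agree exactly when the associated element u w v w^-1 (resp. the conjugate
   of the cycle) is trivial.  Hence, if every pump of the grammar or every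
   cycle of the diagram is trivial, a word of L may be shortened without
   changing its value until it lies in one of the finite base sets.
   Conversely, a pump or a cycle occurring in an accepted word is the quotient
   of two elements of L, since every variable is useful and every cycle
   considered can be continued to a final state. *)
Require Import Defs.
From Stdlib Require Import Relation_Operators Operators_Properties.
From mathcomp Require Import all_boot.
From mathcomp Require Import classical_sets zify.

Set Implicit Arguments.
Unset Strict Implicit.
Unset Printing Implicit Defensive.

Local Open Scope classical_set_scope.

(** Non-emptiness is isolated because it is obtained from an element of the language; the converse
    implications use the inclusion alone. *)
Lemma eq_set1P (T : Type) (W : set T) (e : T) :
  W = [set e] <-> W !=set0 /\ W `<=` [set e].
Proof.
split=> [-> |[[y Wy] We]]; first by split=> //; exists e.
apply/seteqP; split=> // _ ->; by rewrite -(We _ Wy).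
Qed.

Lemma conjg_eq1P (G : groupType) (a c : G) :
  (a * c * a^-1)%g = 1%g <-> c = 1%g.
Proof.
split=> [H|->]; last by rewrite mulg1 mulgV.
by apply: (mulgI a); apply: (mulIg (a^-1)%g); rewrite H mulg1 mulgV.
Qed.

(** * Values of words in the group *)

Section Words.
Variables (G : groupType) (m : nat) (x : 'I_m -> G).

Lemma word_val_cat (u v : word m) :
  word_val x (u ++ v) = (word_val x u * word_val x v)%g.
Proof. by rewrite /word_val big_cat. Qed.

Lemma word_val_inv (w : word m) :
  word_val x (inv_word w) = ((word_val x w)^-1)%g.
Proof.
rewrite /word_val; elim: w => [|a w IH]; first by rewrite !big_nil invg1.
rewrite /inv_word /= rev_cons -cats1 big_cat big_seq1 big_cons invgM.
congr (_ * _)%g; first exact: IH.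
by rewrite /letter_val /=; case: a.2; rewrite //= invgK.
Qed.

Lemma pump_val1P (u w v : word m) :
  word_val x (u ++ w ++ v ++ inv_word w) = 1%g <->
  word_val x (u ++ w ++ v) = word_val x w.
Proof.
have -> : u ++ w ++ v ++ inv_word w = (u ++ w ++ v) ++ inv_word w.
  by rewrite !catA.
rewrite word_val_cat word_val_inv; split=> [H|->]; last by rewrite mulgV.
by apply: (mulIg ((word_val x w)^-1)%g); rewrite H mulgV.
Qed.

End Words.

(** * Derivations in the grammar and the set [W1] *)

Section Grammar.
Variables (m : nat) (Gam : cfg m).
Implicit Types s t : sform Gam.

Lemma derives_context s t (al be : sform Gam) :
  derives s t -> derives (al ++ s ++ be) (al ++ t ++ be).
Proof.
elim=> {s t} [s t [B [ga [a [b [Bga -> ->]]]]]|s|s t u _ IH1 _ IH2].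
- apply: rt_step; exists B, ga, (al ++ a), (b ++ be).
  by split; rewrite // -?catA ?cat_cons -?catA.
- exact: rt_refl.
- exact: rt_trans IH1 IH2.
Qed.

(** A production rewrites a single variable, so each step acts inside one of the two factors and
    leaves the other unchanged. *)
Lemma derives_catW s1 s2 t : derives (s1 ++ s2) t ->
  exists t1 t2, [/\ t = t1 ++ t2, derives s1 t1 & derives s2 t2].
Proof.
move Es : (s1 ++ s2) => s st.
elim: st s1 s2 Es => {s t} [s t st|s|s t u _ IH1 _ IH2] s1 s2 Es.
- have [B [ga [a [b [Bga Es' ->]]]]] := st.
  rewrite {}Es' {st} in Es.
  (* Induction on [s1] decides in which factor the rewritten variable lies. *)
  elim: s1 a Es => [|y s1 IH] a /= Es.
    exists [::], (a ++ ga ++ b); split=> //; first exact: rt_refl.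
    by apply: rt_step; exists B, ga, a, b.
  case: a Es => [|y' a] /= [Ey Es].
    exists (ga ++ s1), s2; split; [by rewrite -Es catA| |exact: rt_refl].
    by apply: rt_step; exists B, ga, [::], s1; split; rewrite // Ey.
  have [t1 [t2 [Et H1 H2]]] := IH _ Es.
  exists (y :: t1), t2; split=> //; first by rewrite /= Et Ey.
  by have := derives_context [:: y] [::] H1; rewrite !cats0.
- by exists s1, s2; split=> //; exact: rt_refl.
- have [t1 [t2 [Et H1 H2]]] := IH1 _ _ Es.
  have [u1 [u2 [Eu H3 H4]]] := IH2 _ _ (esym Et).
  by exists u1, u2; split=> //; [exact: rt_trans H3|exact: rt_trans H4].
Qed.

Lemma term_cat (u v : word m) :
  term Gam (u ++ v) = term Gam u ++ term Gam v.
Proof. exact: map_cat. Qed.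

Lemma term_catW (w : word m) t1 t2 : term Gam w = t1 ++ t2 ->
  exists w1 w2, [/\ w = w1 ++ w2, t1 = term Gam w1 & t2 = term Gam w2].
Proof.
move=> E; exists (take (size t1) w), (drop (size t1) w).
split; first by rewrite cat_take_drop.
- by rewrite /term map_take -/(term Gam w) E take_size_cat.
- by rewrite /term map_drop -/(term Gam w) E drop_size_cat.
Qed.

(** A terminal derivation through [B] splits into the parts derived from [al], [B] and [be]. The
    outer parts are [a] and [b]; the middle one can be exchanged for any [w] derived from [B]. *)
Lemma useful_context (B : cfg_var Gam) : useful B ->
  exists a b : word m, forall w : word m,
    derives [:: inl B] (term Gam w) -> cfg_lang Gam (a ++ w ++ b).
Proof.
move=> [al [be [z [Sz zz]]]].
have [t1 [t' [E H1 H']]] := derives_catW zz.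
have [a [z' [_ Ea Ez']]] := term_catW E.
have [t2 [t3 [E3 H2 H3]]] := @derives_catW [:: inl B] be _ H'.
rewrite Ez' in E3; have [_ [b [_ _ Eb]]] := term_catW E3.
subst t1 t3; exists a, b => w Bw; apply: (rt_trans _ _ _ _ _ Sz).
rewrite !term_cat.
apply: (rt_trans _ _ _ (term Gam a ++ [:: inl B] ++ be)).
  by have := derives_context [::] ([:: inl B] ++ be) H1.
apply: (rt_trans _ _ _ (term Gam a ++ [:: inl B] ++ term Gam b)).
  by have := derives_context (term Gam a ++ [:: inl B]) [::] H3;
    rewrite !cats0 -!catA.
exact: derives_context.
Qed.

Lemma W1_identityP (G : groupType) (x : 'I_m -> G) (r : nat) :
    pumping_constant Gam r -> (forall B : cfg_var Gam, useful B) ->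
    cfg_lang Gam !=set0 ->
  cfg_lang Gam `<=` identity_language x <->
  W1 x (cfg_lang Gam) Gam r = [set 1%g].
Proof.
move=> pumpG usefulG [z0 Lz0]; rewrite eq_set1P; split=> [L1|[_ W1e] z].
  split.
    (* A short [z0] lies in [Omega1]; a long one contains a pump, which yields an element of
       [Omega2]. *)
    have [le_rz|lt_zr] := leqP r (size z0).
      have [z1 [u [w [v [z2 [_ ? ? _ [B [_ ? ?]]]]]]]] := pumpG _ Lz0 le_rz.
      exists (word_val x (u ++ w ++ v ++ inv_word w)).
      exists (u ++ w ++ v ++ inv_word w) => //.
      by right; exists u, w, v; split=> //; exists B.
    by exists (word_val x z0), z0 => //; left; split=> //; exact: ltnW.
  move=> _ [z [[Lz _]|[u [w [v [-> _ _ [B [Buv Bw]]]]]]] <-]; first exact: L1.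
  apply/pump_val1P; have [a [b Lab]] := useful_context (usefulG B).
  have Buwv : derives [:: inl B] (term Gam (u ++ w ++ v)).
    rewrite !term_cat; apply: (rt_trans _ _ _ _ _ Buv).
    exact: (derives_context _ _ Bw).
  (* Both [a ++ (u ++ w ++ v) ++ b] and [a ++ w ++ b] have value 1; the outer factors cancel. *)
  apply: (mulgI (word_val x a)); apply: (mulIg (word_val x b)).
  rewrite -!mulgA -!(word_val_cat x) -!catA.
  by have := L1 _ (Lab _ Buwv); rewrite -!catA => ->; rewrite (L1 _ (Lab _ Bw)).
have [k] := ubnP (size z); elim: k z => // k IH z le_zk Lz.
have [le_rz|lt_zr] := leqP r (size z); last first.
  by apply: W1e; exists z => //; left; split=> //; exact: ltnW.
have [z1 [u [w [v [z2 [Ez ruwv uv_neq0 Lpump [B [_ Buv Bw]]]]]]]] :=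
  pumpG _ Lz le_rz.
have uwv : word_val x (u ++ w ++ v) = word_val x w.
  apply/pump_val1P/W1e; exists (u ++ w ++ v ++ inv_word w) => //.
  by right; exists u, w, v; split=> //; exists B.
(* Exponent 0 deletes [u] and [v], which are not both empty, so the new word is strictly shorter. *)
have Lw : cfg_lang Gam (z1 ++ w ++ z2) := Lpump 0.
have uv_gt0 : 0 < size u + size v by rewrite -size_cat lt0n size_eq0; apply/eqP.
have ltz : size (z1 ++ w ++ z2) < k.
  by move: le_zk; rewrite Ez !size_cat; lia.
apply: etrans (IH _ ltz Lw); rewrite Ez.
have -> : z1 ++ u ++ w ++ v ++ z2 = z1 ++ (u ++ w ++ v) ++ z2 by rewrite -!catA.
by rewrite 2!word_val_cat uwv -!word_val_cat.
Qed.

End Grammar.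

(** * Walks, first loops and the sets [K] *)

Section Diagram.
Variables (m n : nat) (A : nfa m n).
Implicit Types (i j k t : 'I_n.+1) (p q c : seq (Defs.arc m n)).

Lemma is_walk_cat i p q j :
  is_walk A i (p ++ q) j <-> exists2 k, is_walk A i p k & is_walk A k q j.
Proof.
elim: p i => [|b p IH] i /=; first by split=> [|[_ <-]] //; exists i.
split=> [[Ab /IH[k pk qj]]|[k [Ab pk] qj]]; first by exists k.
by split=> //; apply/IH; exists k.
Qed.

Lemma is_walk_rcons i p b j :
  is_walk A i (rcons p b) j <->
  is_walk A i p (arc_src b) /\ arcs A (arc_src b) j b.
Proof.
rewrite -cats1 is_walk_cat; split=> [[k pk [[bk _ Ab] bj]]|[pk [_ bj Ab]]].
  by rewrite bk; split=> //; split=> //; rewrite -bj.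
by exists (arc_src b).
Qed.

(** Both lists run through the vertices in order. This relates distinctness of targets, as in
    [Phat], to distinctness of sources, as in [K_uniq]. *)
Lemma walk_vertices i p j :
  is_walk A i p j -> i :: map (@arc_tgt m n) p = rcons (map (@arc_src m n) p) j.
Proof. by elim: p i => [i -> //|b p IH] i /= [[-> _ _] /IH->]. Qed.

Lemma mem_nfa_run i w j :
  j \in nfa_run A i w <->
  exists2 p, is_walk A i p j & map (@arc_letter m n) p = w.
Proof.
elim/last_ind: w j => [|w a IH] j.
  rewrite inE; split=> [/eqP->|[[|//] /= -> _] //]; by exists [::].
rewrite /nfa_run foldl_rcons -/(nfa_run A i w); split.
  case/bigcupP=> k /IH[p pk <-] kaj; exists (rcons p (k, a, j)).
    exact/is_walk_rcons.
  by rewrite map_rcons.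
case; elim/last_ind => [_ /(congr1 size)|p b _]; first by rewrite size_rcons.
rewrite map_rcons => /is_walk_rcons[pk [_ bj Ab]] /rcons_inj[Ew Ea].
apply/bigcupP; exists (arc_src b); first by apply/IH; exists p.
by rewrite -bj -Ea.
Qed.

Lemma nfa_langP w :
  nfa_lang A w <-> exists2 p, PZ A ord0 p & map (@arc_letter m n) p = w.
Proof.
split=> [/set0Pn[t /setIP[/mem_nfa_run[p pt Ew] Zt]]|[p [t Zt pt] Ew]].
  by exists p => //; exists t.
by apply/set0Pn; exists t; apply/setIP; split=> //; apply/mem_nfa_run; exists p.
Qed.

(* The first return to a vertex already visited closes the cycle c. *)
Lemma first_loop i p j :
  is_walk A i p j -> ~~ uniq (i :: map (@arc_tgt m n) p) ->
  exists p1 c q k, [/\ p = p1 ++ c ++ q, c <> [::],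
    is_walk A i p1 k /\ uniq (i :: map (@arc_tgt m n) p1),
    is_walk A k c k /\ uniq (map (@arc_tgt m n) c) & is_walk A k q j].
Proof.
elim/last_ind: p j => [//|p b IH] j /is_walk_rcons[pw [_ bj Ab]].
(* A repetition before the last arc is left to induction; otherwise the endpoint [j] of [b] is the
   first repeated vertex. *)
have [up|/(IH _ pw)[p1 [c [q [k [Ep c0 wp1 wc wq]]]]] _] :=
    boolP (uniq (i :: map (@arc_tgt m n) p)); last first.
  exists p1, c, (rcons q b), k; split=> //; first by rewrite Ep !rcons_cat.
  exact/is_walk_rcons.
rewrite map_rcons -rcons_cons rcons_uniq bj up andbT negbK => jp.
(* Cut [p] at its earlier visit to [j]. *)
have [p1 [p2 [Ep p1j]]] : exists p1 p2, p = p1 ++ p2 /\ is_walk A i p1 j.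
  move: jp pw; rewrite inE => /predU1P[-> _|]; first by exists [::], p.
  case/mapP=> b' /splitPr[q1 q2] Ej /is_walk_cat[k q1k /= [[b'k _ Ab'] _]].
  exists (rcons q1 b'), q2; split; first by rewrite cat_rcons.
  by apply/is_walk_rcons; split; rewrite ?b'k // Ej.
move: pw up; rewrite Ep => /is_walk_cat[k p1k p2b].
have kj : k = j.
  have := congr1 (last i) (walk_vertices p1k).
  by rewrite (walk_vertices p1j) !last_rcons.
rewrite {k p1k}kj in p2b.
rewrite map_cat -cat_cons cat_uniq => /and3P[up1 /hasPn p12 up2].
exists p1, (rcons p2 b), [::], j; split=> //.
- by rewrite cats0 rcons_cat.
- by case: {+}p2.
- split; first by apply/is_walk_rcons.
  (* The vertex [j] already lies on [p1], so it is not a target in [p2]. *)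
  rewrite map_rcons rcons_uniq up2 andbT bj; apply/negP=> /p12 /negP; apply.
  by rewrite (walk_vertices p1j) mem_rcons mem_head.
Qed.

(** The cycle [c] enters [O_] by the second alternative in [Phat]: its targets are distinct, and its
    initial vertex recurs only at the end. *)
Lemma Phat_or_loop i p j : is_walk A i p j ->
  Phat A i j p \/
  exists p1 c q k, [/\ p = p1 ++ c ++ q, c <> [::],
    Phat A i k p1, O_ A k c & is_walk A k q j].
Proof.
move=> pw; have [up|/(first_loop pw)] :=
  boolP (uniq (i :: map (@arc_tgt m n) p)); first by left; split; rewrite ?up.
case=> p1 [c [q [k [Ep c0 [wp1 up1] [wc uc] wq]]]]; right.
exists p1, c, q, k; split=> //; first by split; rewrite ?up1.
by split=> //; rewrite uc eqxx orbT.
Qed.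

(* The sources of all arcs but the first are the interior vertices of p. *)
Lemma K_uniq l i p j : is_walk A i p j -> p <> [::] ->
  uniq (map (@arc_src m n) (behead p)) ->
  (forall b, b \in behead p -> arc_src b < l) -> l <= n.+1 -> K A l i j p.
Proof.
elim: l i p j => [|l IH] i p j wp p0 up lt_pl le_ln.
  (* Without admissible interior vertices, [p] is a single arc. *)
  case: p wp p0 lt_pl {up} => [//|b [|b' p]] /= [Ab].
    by move=> <- _ _; exists b.
  by move=> _ _ /(_ b' (mem_head _ _)).
(* If [inord l] is not an interior vertex, the bound drops to [l]; otherwise [p] is cut at its only
   interior visit there. *)
have [/mapP[b pb lb]|Nl] :=
    boolP (inord l \in map (@arc_src m n) (behead p)); last first.
  left; apply: IH => //; last exact: ltnW.
  move=> b pb; have := lt_pl b pb; rewrite ltnS leq_eqVlt => /predU1P[El|//].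
  by case/mapP: Nl; exists b => //; rewrite -El inord_val.
right; case: p wp p0 up lt_pl pb => [//|a p] /= [Aa wp] _ up lt_pl pb.
case/splitPr: pb => p1 p2 in wp up lt_pl *.
(* As [l < n.+1], the state [inord l] has number [l] and is not the default value. *)
have lE : arc_src b = l :> nat by rewrite -lb inordK.
have [k p1k [[bk _ Ab] p2j]] : exists2 k, is_walk A (arc_tgt a) p1 k &
    arcs A k (arc_tgt b) b /\ is_walk A (arc_tgt b) p2 j.
  by move/is_walk_cat: wp.
rewrite lb.
move: up; rewrite map_cat cat_uniq /= => /and3P[up1 Nb /andP[bp2 up2]].
have lt_p q : (forall b', b' \in q -> b' \in p1 ++ b :: p2) ->
    arc_src b \notin map (@arc_src m n) q ->
    forall b', b' \in q -> arc_src b' < l.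
  move=> qp Nq b' qb'; have := lt_pl b' (qp _ qb').
  rewrite ltnS leq_eqVlt => /predU1P[El|//].
  case/negP: Nq; apply/mapP; exists b' => //.
  by apply: val_inj; rewrite /= El.
exists (a :: p1).
  apply: IH; rewrite ?bk ?(ltnW le_ln) //.
  apply: lt_p => [b' qb'|]; first by rewrite mem_cat qb'.
  by move: Nb; rewrite negb_or => /andP[].
exists (b :: p2) => //; apply: IH; rewrite ?(ltnW le_ln) //.
by apply: lt_p => // b' qb'; rewrite mem_cat inE qb' !orbT.
Qed.

(** Only interior vertices must be distinct, so the first loop is sought in [p] without its first
    and last arcs. Restoring these arcs makes the prefix and [q] non-empty, as membership in [K] and
    a continuation from [k] demand. *)
Lemma K_or_loop i p j : is_walk A i p j -> p <> [::] ->
  K A n.+1 i j p \/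
  exists p1 c q k, [/\ p = p1 ++ c ++ q, c <> [::] /\ q <> [::],
    K A n.+1 i k p1, K A n.+1 k k c & is_walk A k q j].
Proof.
move=> wp p0.
have [up|Nup] := boolP (uniq (map (@arc_src m n) (behead p))); [left|right].
  by apply: K_uniq.
case: p wp p0 Nup => [//|a p] [Aa wp] _; rewrite [behead _]/=.
case/lastP: p wp => [//|p d] /is_walk_rcons[wp Ad].
rewrite map_rcons -(walk_vertices wp) => /(first_loop wp).
case=> p1 [c [q [k [-> c0 [wp1 up1] [wc uc] wq]]]].
exists (a :: p1), c, (rcons q d), k; split.
- by rewrite /= !rcons_cat.
- by split=> //; case: {+}q.
- apply: K_uniq => //=; move: up1; rewrite (walk_vertices wp1).
  by rewrite rcons_uniq => /andP[].
- apply: K_uniq => //; case: c c0 wc uc => [//|b c] _ [_ wc].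
  by rewrite map_cons [behead _]/= (walk_vertices wc) rcons_uniq => /andP[].
- exact/is_walk_rcons.
Qed.

Lemma K_is_walk l i j p : K A l i j p -> is_walk A i p j.
Proof.
elim: l i j p => [|l IH] i j p /=.
  by move=> [b [bi bj Ab] <-] /=; rewrite bj.
case=> [/IH //|[p1 /IH wp1 [p2 /IH wp2 <-]]].
by apply/is_walk_cat; exists (inord l).
Qed.

Lemma size_ind (P : seq (Defs.arc m n) -> Prop) :
  (forall p, (forall q, size q < size p -> P q) -> P p) -> forall p, P p.
Proof.
move=> IH p; have [k] := ubnP (size p).
by elim: k p => // k IHk p /ltnSE lepk; apply: IH => q /leq_trans/(_ lepk)/IHk.
Qed.

Lemma size_cut p c q : c <> [::] -> size (p ++ q) < size (p ++ c ++ q).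
Proof. by case: c => // b c _; rewrite !size_cat /=; lia. Qed.

(** * Values of walks and the sets [W2] and [W3] *)

Section Values.
Variables (G : groupType) (x : 'I_m -> G).

Lemma walk_val_cat p q :
  walk_val x (p ++ q) = (walk_val x p * walk_val x q)%g.
Proof. by rewrite /walk_val big_cat. Qed.

Lemma walk_val_cut p c q :
  (walk_val x p * walk_val x c * (walk_val x p)^-1)%g = 1%g ->
  walk_val x (p ++ c ++ q) = walk_val x (p ++ q).
Proof. by move/conjg_eq1P=> c1; rewrite !walk_val_cat c1 mul1g. Qed.

Lemma loop_val1 p c q :
  walk_val x (p ++ c ++ q) = 1%g -> walk_val x (p ++ q) = 1%g ->
  (walk_val x p * walk_val x c * (walk_val x p)^-1)%g = 1%g.
Proof.
rewrite !walk_val_cat => pcq pq; apply/conjg_eq1P.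
apply: (mulgI (walk_val x p)); apply: (mulIg (walk_val x q)).
by rewrite mulg1 -mulgA pcq pq.
Qed.

Lemma nfa_identityP :
  nfa_lang A `<=` identity_language x <->
  (forall p, PZ A ord0 p -> walk_val x p = 1%g).
Proof.
have valE p : word_val x (map (@arc_letter m n) p) = walk_val x p.
  by rewrite /word_val big_map.
split=> [L1 p Zp|P1 w /nfa_langP[p Zp <-]].
  by rewrite -valE; apply: L1; apply/nfa_langP; exists p.
exact: etrans (valE p) (P1 p Zp).
Qed.

(** Removing first loops from an accepted walk ends in [PhatZ]; this gives non-emptiness and, when
    the loops are trivial, preserves the value. Conversely, the walk to a final state in [Omega4]
    completes the path both with and without its cycle. *)
Lemma W2_identityP : nfa_lang A !=set0 ->
  nfa_lang A `<=` identity_language x <-> W2 x A = [set 1%g].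
Proof.
move=> [w /nfa_langP[p0 Zp0 _]]; rewrite nfa_identityP eq_set1P.
split=> [P1|[_ W2e]]; [split|].
- case: Zp0 => t Zt; elim/size_ind: p0 => p IH pt.
  have [pp|[p1 [c [q [k [Ep c0 [p1k _] _ qt]]]]]] := Phat_or_loop pt.
    by exists (walk_val x p); left; exists p => //; exists t.
  apply: (IH (p1 ++ q)); first by rewrite Ep size_cut.
  by apply/is_walk_cat; exists k.
- move=> _ [[p [t Zt [pt _]] <-]|[j [p [c [q [[pj _] [cj _] [t Zt qt] ->]]]]]].
    by apply: P1; exists t.
  apply: (loop_val1 (q := q)); apply: P1; exists t => //; apply/is_walk_cat.
    by exists j => //; apply/is_walk_cat; exists j.
  by exists j.
- move=> p [t Zt]; elim/size_ind: p => p IH pt.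
  have [pp|[p1 [c [q [k [Ep c0 p1k cc qt]]]]]] := Phat_or_loop pt.
    by apply: W2e; left; exists p => //; exists t.
  rewrite Ep walk_val_cut; last first.
    by apply: W2e; right; exists k, p1, c, q; split=> //; exists t.
  apply: IH; first by rewrite Ep size_cut.
  by apply/is_walk_cat; exists k => //; case: p1k.
Qed.

(** Every walk in [K] has an arc, so a non-empty accepted word is what provides an element of
    [W3]. *)
Lemma W3_identityP : (exists2 w, nfa_lang A w & w <> [::]) ->
  nfa_lang A `<=` identity_language x <-> W3 x A = [set 1%g].
Proof.
(* Loops are cut while the remainder stays non-empty. This serves both [Omega5] and the condition on
   [K A n.+1 j t] in [Omega6]. *)
have Kex i p j : is_walk A i p j -> p <> [::] -> K A n.+1 i j !=set0.
  elim/size_ind: p => p IH pj p0.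
  have [pK|[p1 [c [q [k [Ep [c0 q0] /K_is_walk p1k _ qt]]]]]] :=
    K_or_loop pj p0; first by exists p.
  apply: (IH (p1 ++ q)); first by rewrite Ep size_cut.
    by apply/is_walk_cat; exists k.
  by case: {+}p1.
move=> [w /nfa_langP[p0 [t0 Zt0 p0t0] Ew] w0].
rewrite nfa_identityP eq_set1P; split=> [P1|[_ W3e]]; [split|].
- have [|p pK] := Kex _ _ _ p0t0; first by move=> p00; case: w0; rewrite -Ew p00.
  by exists (walk_val x p); left; exists t0, p.
- move=> _ [[t [p [Zt /K_is_walk pt ->]]]|[j [t [p [c [Zt [q /K_is_walk qt]
    /K_is_walk pj /K_is_walk cj ->]]]]]]; first by apply: P1; exists t.
  apply: (loop_val1 (q := q)); apply: P1; exists t => //; apply/is_walk_cat.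
    by exists j => //; apply/is_walk_cat; exists j.
  by exists j.
- move=> p [t Zt]; elim/size_ind: p => p IH pt.
  (* The empty walk lies in no [K], but its value is 1 outright. *)
  have [->|/eqP p_neq0] := eqVneq p [::]; first by rewrite /walk_val big_nil.
  have [pK|[p1 [c [q [k [Ep [c0 q0] p1k cc qt]]]]]] := K_or_loop pt p_neq0.
    by apply: W3e; left; exists t, p.
  rewrite Ep walk_val_cut; last first.
    apply: W3e; right; exists k, t, p1, c; split=> //; exact: Kex qt q0.
  apply: IH; first by rewrite Ep size_cut.
  by apply/is_walk_cat; exists k => //; exact: K_is_walk p1k.
Qed.

End Values.
End Diagram.

Unset Implicit Arguments.

Theorem theorem2p1 (G : groupType) (m : nat) (x : 'I_m -> G)
    (x_gen : generates x) (G_dec : decidable_word_problem x)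
    (L : set (word m))
    (n : nat) (A : nfa m n) (L_A : L = nfa_lang A)
    (Gam : cfg m) (L_Gam : L = cfg_lang Gam)
    (r : nat) (r_pump : pumping_constant Gam r)
    (Gam_reduced : forall B : cfg_var Gam, useful B)
    (L_nontrivial : exists2 w, L w & w <> [::]) :
  [<-> L `<=` identity_language x;
       W1 x L Gam r = [set 1%g];
       W2 x A = [set 1%g];
       W3 x A = [set 1%g]].
Proof.
have L0 : L !=set0 by case: L_nontrivial => w Lw _; exists w.
have iff1 : L `<=` identity_language x <-> W1 x L Gam r = [set 1%g].
  by rewrite L_Gam in L0 *; apply: W1_identityP.
have iff2 : L `<=` identity_language x <-> W2 x A = [set 1%g].
  by rewrite L_A in L0 *; apply: W2_identityP.
have iff3 : L `<=` identity_language x <-> W3 x A = [set 1%g].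
  by rewrite L_A in L_nontrivial *; apply: W3_identityP.
(* The cycle of implications passes through the first condition at each middle step. *)
tfae; first exact: iff1.1.
- by move/iff1.2/iff2.1.
- by move/iff2.2/iff3.1.
- exact: iff3.2.
Qed.
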